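(* Let $q$ be an asymmetric lattice norm on $\mathbb R^2$ and let $K\subseteq\mathbb R^2$. The following statements are equivalent. (i) $K$ is a $q$-compact convex body. (ii) One of the following holds: (1) there is a point $(u,v)\in\mathbb R^2$ such that $$K=\{(u,t_0),(u,v)]\cup\{(s_0,v),(u,v)]\cup\big((u,v)+(\theta_0)^o\big)$$ for some $-\infty\le t_0\le v$ and $-\infty\le s_0\le u$; or (2) there are real numbers $\alpha<u$ and $\beta<v$, elements $-\infty\le s_0\le\alpha$ and $-\infty\le t_0\le\beta$, and a $q^s$-compact convex set $K_0$ satisfying $$\mathrm{co}\{(\alpha,v),(\alpha,\beta),(u,\beta)\}\subseteq K_0\subseteq \mathrm{co}\{(\alpha,v),(\alpha,\beta),(u,\beta),(u,v)\},$$ $$K_0\subset K\subset K_0+\theta_0,$$ and such that $$K=K_0\cup\big((\alpha,v)+(\theta_0)^o\big)\cup\big((u,\beta)+(\theta_0)^o\big)\cup\{(u,t_0),(u,\beta)]\cup\{(s_0,v),(\alpha,v)].$$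
   Context: A lattice norm on $\mathbb R^2$ (with the coordinatewise order) is a norm $\|\cdot\|$ such that $\|x\|\le\|y\|$ whenever $|x|\le|y|$ coordinatewise. An asymmetric lattice norm is a function of the form $q(x)=\|x\vee 0\|$, where $\|\cdot\|$ is a lattice norm and $x\vee 0$ is the coordinatewise maximum of $x$ and $0$. The $q$-topology on $\mathbb R^2$ is the (non-Hausdorff) topology generated by the balls $B^q_\varepsilon(x)=\{y: q(y-x)<\varepsilon\}$, $\varepsilon>0$. The function $q^s(x)=\max\{q(x),q(-x)\}$ is a norm on $\mathbb R^2$, and the $q^s$-topology is its norm topology. A set is $q$-compact (resp. $q^s$-compact) if it is compact in the $q$-topology (resp. the $q^s$-topology); compactness means that every open cover has a finite subcover (no separation axiom is required). A $q$-compact convex body is a convex $q$-compact subset of $\mathbb R^2$ whose interior in the $q$-topology is non-empty. Put $\theta_0=\{x\in\mathbb R^2: q(x)=0\}=(-\infty,0]\times(-\infty,0]$; $(\theta_0)^o$ is its interior in the $q$-topology, i.e. $(\theta_0)^o=(-\infty,0)\times(-\infty,0)$. $\mathrm{co}$ denotes convex hull. For $x,y\in\mathbb R^2$, the symbol $\{x,y]$ means either the closed segment $[x,y]$ or the half-open segment $(x,y]=[x,y]\setminus\{x\}$ (the choice is made independently for each occurrence, so in (ii) the representation is required to hold for some choice). When $x=y$, $\{x,y]$ means the one-point set $\{y\}$. When the left endpoint has a coordinate $-\infty$, the symbol means the corresponding closed half-line: $\{(u,-\infty),(u,w)]=\{(u,t):t\le w\}$ and $\{(-\infty,w),(z,w)]=\{(s,w):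 s\le z\}$. *)

(* Defs.v *)
From HB Require Import structures.
From mathcomp Require Import all_boot all_order all_algebra.
From mathcomp Require Import all_classical all_reals all_analysis.

Set Implicit Arguments.
Unset Strict Implicit.
Unset Printing Implicit Defensive.

Import Order.TTheory GRing.Theory Num.Theory.
Import numFieldNormedType.Exports.

Local Open Scope classical_set_scope.
Local Open Scope ring_scope.
Local Open Scope convex_scope.

Definition plane (R : realType) : lmodType R := (R^o * R^o)%type.

Definition pt (R : realType) (a b : R) : plane R := (a, b).

(* Nonnegativity of N follows from homogeneity and subadditivity. *)
Record lattice_norm (R : realType) (N : plane R -> R) : Prop := {
  lattice_norm_eq0 : forall x, N x = 0 -> x = 0;
  lattice_normZ : forall (a : R) x, N (a *: x) = `|a| * N x;
  ler_lattice_normD : forall x y, N (x + y) <= N x + N y;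
  ler_lattice_norm : forall x y,
    `|x.1| <= `|y.1| -> `|x.2| <= `|y.2| -> N x <= N y }.

Definition pos_part (R : realType) (x : plane R) : plane R :=
  pt (Num.max x.1 0) (Num.max x.2 0).

Definition asym_lattice_norm (R : realType) (q : plane R -> R) : Prop :=
  exists2 N, lattice_norm N & forall x, q x = N (pos_part x).

Definition sym_norm (R : realType) (q : plane R -> R) (x : plane R) : R :=
  Num.max (q x) (q (- x)).

Definition qball (R : realType) (q : plane R -> R) (x : plane R) (e : R)
  : set (plane R) := [set y | q (y - x) < e].

(* The plane with the topology generated by the balls [qball q x e], e > 0.
   Taking [sym_norm q] in place of [q] gives the norm topology of
   [sym_norm q]. *)
Definition qplane (R : realType) (q : plane R -> R) : Type := plane R.

HB.instance Definition _ (R : realType) (q : plane R -> R) :=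
  Choice.copy (qplane q) (plane R).

HB.instance Definition _ (R : realType) (q : plane R -> R) :=
  @isSubBaseTopological.Build (qplane q) (R * R * R)%type
    [set i | 0 < i.2] (fun i => qball q i.1 i.2).

Definition qcompact (R : realType) (q : plane R -> R) (A : set (plane R)) :=
  cover_compact (A : set (qplane q)).

Definition qinterior (R : realType) (q : plane R -> R) (A : set (plane R))
  : set (plane R) := interior (A : set (qplane q)).

Definition qcompact_convex_body (R : realType) (q : plane R -> R)
    (K : set (plane R)) : Prop :=
  [/\ convex_set K, qcompact q K & qinterior q K !=set0].

Definition theta0 (R : realType) (q : plane R -> R) : set (plane R) :=
  [set x | q x = 0].

Definition convex_hull (R : realType) (A : set (plane R)) : set (plane R) :=
  smallest (@convex_set R (plane R)) A.

Definition sumset (R : realType) (A B : set (plane R)) : set (plane R) :=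
  [set a + b | a in A & b in B].

Definition translate (R : realType) (p : plane R) (A : set (plane R))
  : set (plane R) := [set p + a | a in A].

Definition segment (R : realType) (x y : plane R) : set (plane R) :=
  [set (x : convex_lmodType (plane R)) <| t |> y | t in [set: {i01 R}]].

(* The segment with right endpoint y included; the left endpoint x is included
   iff c holds, except that the segment is [set y] whenever x = y. *)
Definition lsegment (R : realType) (c : bool) (x y : plane R)
  : set (plane R) :=
  if x == y then [set y]
  else if c then segment x y else segment x y `\ x.

(* The left endpoint of these axis-parallel segments may be -oo, in which case
   they are closed half-lines and c is irrelevant.  The value at +oo is junk. *)
Definition vsegment (R : realType) (c : bool) (u : R) (t0 : \bar R) (w : R)
  : set (plane R) :=
  match t0 with
  | t%:E => lsegment c (pt u t) (pt u w)
  | -oo%E => [set pt u t | t in [set t | t <= w]]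
  | +oo%E => set0
  end.

Definition hsegment (R : realType) (c : bool) (s0 : \bar R) (w z : R)
  : set (plane R) :=
  match s0 with
  | s%:E => lsegment c (pt s w) (pt z w)
  | -oo%E => [set pt s w | s in [set s | s <= z]]
  | +oo%E => set0
  end.

(* Main.v *)
(* q-open sets are stable under decreasing the coordinates, and q is equivalent
   to the sup norm of the positive part.  So a q-compact set attains the maxima
   of its coordinates, and a convex set with q-interior contains the open lower
   left quadrant at each of its points.

   For a q-compact convex body K let u, v be the maxima of the two coordinates,
   and let (u, beta) and (alpha, v) be the highest, resp. rightmost, points of K
   where they are attained.  If (u, v) is in K, then K is the open quadrant at
   (u, v) together with two edges, which are intervals by convexity.  Otherwise
   alpha < u and beta < v, and K0 is K cut by the rectangle
   [alpha, u] x [beta, v]: by q-compactness a limit z of points of K0 lies below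
   some point of K, and convexity with the points of K far below then puts z
   in K.

   Conversely the sets in (1) and (2) are convex, and they are q-compact because
   each of their points lies below a point of a set that is compact for the
   norm. *)
From HB Require Import structures.
Require Import Defs.
From mathcomp Require Import all_boot all_order all_algebra.
From mathcomp Require Import all_classical all_reals all_analysis.
From mathcomp Require Import ring lra finmap.

Set Implicit Arguments.
Unset Strict Implicit.
Unset Printing Implicit Defensive.

Import Order.TTheory GRing.Theory Num.Theory.
Import numFieldNormedType.Exports.
Local Open Scope classical_set_scope.
Local Open Scope ring_scope.

(** * Topologies generated by the balls of a subadditive function *)

(** The balls are only a subbase. Subadditivity leaves each ball containing x some room around x, so
    a finite intersection of balls still contains a ball about x. The criterion serves both [q] and
    [sym_norm q]. *)
Lemma openP_qball (R : realType) (p : plane R -> R) (p0 : p 0 = 0)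
    (pD : forall x y, p (x + y) <= p x + p y) (U : set (plane R)) :
  open (U : set (qplane p)) <->
  forall x, U x -> exists2 e, 0 < e & qball p x e `<=` U.
Proof.
split.
- move=> [D' sD <-] x [B D'B Bx].
  have [F FD BE] : finI_from [set i : R * R * R | 0 < i.2]
    (fun i => qball p i.1 i.2) B := sD _ D'B.
  have {}Bx : B x := Bx.
  suff [e e0 He] : exists2 e, 0 < e &
      forall i, i \in enum_fset F -> qball p x e `<=` qball p i.1 i.2.
    exists e => // y ye; exists B => //; change (B y).
    by rewrite -BE => i iF; exact: He ye.
  have Fx : forall i, i \in enum_fset F -> p (x - i.1) < i.2.
    by move: Bx; rewrite -BE => Bx i; exact: Bx.
  elim: (enum_fset F) Fx => [|i s IH] Fx; first by exists 1 => // i; rewrite in_nil.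
  have [j js|e e0 He] := IH; first by apply: Fx; rewrite inE js orbT.
  exists (Num.min e (i.2 - p (x - i.1))).
    by rewrite lt_min e0 subr_gt0 Fx// inE eqxx.
  move=> j; rewrite inE => /predU1P[->|js] y; rewrite /qball/= lt_min => /andP[ye yi].
    rewrite (_ : y - i.1 = (y - x) + (x - i.1)); last by rewrite addrA subrK.
    by apply: le_lt_trans (pD _ _) _; rewrite -ltrBrDr.
  exact: He.
- move=> H; rewrite openE => x Ux.
  have [e e0 He] := H x Ux.
  rewrite /interior nbhsE; exists (qball p x e) => //; split.
    exists [set qball p x e].
      move=> B ->; exists [fset (x, e)]%fset; last first.
        apply/seteqP; split => y; first by move=> /(_ (x, e)); apply; rewrite /= inE.
        by move=> ? i /=; rewrite inE => /eqP ->.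
      move=> i; rewrite !inE => /eqP ->; exact: mem_set.
    exact: bigcup_set1.
  by rewrite /qball/= subrr p0.
Qed.

(** * Convex sets in coordinates *)

Section Plane.
Variable R : realType.
Implicit Types (K : set (plane R)) (x y z : plane R).

Lemma pt_eta x : x = pt x.1 x.2.
Proof. by case: x. Qed.

Lemma convex_setP K : convex_set K <-> forall x y (t : R), 0 <= t -> t <= 1 ->
  K x -> K y -> K (pt (t * x.1 + (1 - t) * y.1) (t * x.2 + (1 - t) * y.2)).
Proof.
split=> [cK x y t t0 t1 Kx Ky|cK x y t /set_mem Kx /set_mem Ky].
  by have /set_mem := cK x y (Itv01 t0 t1) (mem_set Kx) (mem_set Ky).
by apply/mem_set/(cK x y t%:num).
Qed.

Lemma convex_set_open K : (forall x y (t : R), 0 < t -> t < 1 -> K x -> K y ->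
  K (pt (t * x.1 + (1 - t) * y.1) (t * x.2 + (1 - t) * y.2))) -> convex_set K.
Proof.
move=> cK; apply/convex_setW => x y /set_mem Kx /set_mem Ky t t0 t1.
exact/mem_set/(cK x y t%:num).
Qed.

Lemma convex_triple K x y z (a b c : R) : convex_set K -> K x -> K y -> K z ->
  0 <= a -> 0 <= b -> 0 <= c -> a + b + c = 1 ->
  K (pt (a * x.1 + b * y.1 + c * z.1) (a * x.2 + b * y.2 + c * z.2)).
Proof.
move=> /convex_setP cK Kx Ky Kz a0 b0 c0 abc.
have [a1|a1] := eqVneq a 1.
  have [-> ->] : b = 0 /\ c = 0 by split; lra.
  by rewrite a1 !mul0r !mul1r !addr0; case: x Kx.
have a1' : 0 < 1 - a by rewrite subr_gt0 lt_neqAle a1; lra.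
have bc : b / (1 - a) <= 1 by rewrite ler_pdivrMr//; lra.
have Kyz := cK y z (b / (1 - a)) (divr_ge0 b0 (ltW a1')) bc Ky Kz.
have ale1 : a <= 1 by lra.
have -> : c = 1 - a - b by lra.
have := cK x _ a a0 ale1 Kx Kyz; congr (K (pt _ _)) => /=; field; lra.
Qed.

Lemma convex_vertical K (a b c t : R) :
  convex_set K -> K (pt a b) -> K (pt a c) -> b <= t -> t <= c -> K (pt a t).
Proof.
move=> cK Kb Kc bt tc; have [bc|bc] := eqVneq b c.
  by have -> : t = b by lra.
have bc' : 0 < c - b by rewrite subr_gt0 lt_neqAle bc; lra.
have := (convex_setP K).1 cK (pt a c) (pt a b) ((t - b) / (c - b)).
rewrite divr_ge0 ?ler_pdivrMr//; try lra.
move=> /(_ isT) H; have /(_ Kc Kb) := H ltac:(lra).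
by congr (K (pt _ _)) => /=; field; lra.
Qed.

Lemma convex_horizontal K (a b c t : R) :
  convex_set K -> K (pt b a) -> K (pt c a) -> b <= t -> t <= c -> K (pt t a).
Proof.
move=> cK Kb Kc bt tc; have [bc|bc] := eqVneq b c.
  by have -> : t = b by lra.
have bc' : 0 < c - b by rewrite subr_gt0 lt_neqAle bc; lra.
have := (convex_setP K).1 cK (pt c a) (pt b a) ((t - b) / (c - b)).
rewrite divr_ge0 ?ler_pdivrMr//; try lra.
move=> /(_ isT) H; have /(_ Kc Kb) := H ltac:(lra).
by congr (K (pt _ _)) => /=; field; lra.
Qed.

(** * Axis-parallel segments and intervals *)

(** Reflection in the diagonal; it reduces horizontal segments to vertical ones. *)
Definition swap x : plane R := pt x.2 x.1.

Lemma segment_swap x y z : segment x y z -> segment (swap x) (swap y) (swap z).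
Proof. by case=> t _ <-; exists t. Qed.

Lemma lsegment_swap c x y z :
  lsegment c x y z -> lsegment c (swap x) (swap y) (swap z).
Proof.
have swapK w : swap (swap w) = w by case: w.
rewrite /lsegment (inj_eq (can_inj swapK)); case: eqP => [_ ->//|xy].
by case: c => [|[]] /segment_swap // ? zx; split => // /(can_inj swapK).
Qed.

Lemma hsegmentE c (s0 : \bar R) (v u : R) x :
  hsegment c s0 v u x <-> vsegment c v s0 u (swap x).
Proof.
case: s0 => [s| |] /=; last first.
- by split=> [[s ? <-]|[s ? sx]]; exists s => //; case: x sx => ? ? [] -> ->.
- by [].
- by split=> /lsegment_swap //; case: x.
Qed.

(** One description for half-lines and for closed, half-open and degenerate segments. The disjunct
    [x.2 = w] keeps the right endpoint when [t0] equals [w] and [c] is false. *)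
Lemma vsegmentE c (u w : R) (t0 : \bar R) x : (t0 <= w%:E)%E ->
  vsegment c u t0 w x <-> [/\ x.1 = u, x.2 <= w &
    [\/ x.2 = w, (t0 < x.2%:E)%E | c /\ t0 = x.2%:E]].
Proof.
case: t0 => [t| |] //=; last first.
  move=> _; split => [[r rw <-]|[<- xw _]]; last by exists x.2 => //; case: x xw.
  by split=> //; apply: Or32; rewrite ltNyr.
rewrite lee_fin => tw; rewrite /lsegment.
have [twE|ntw] := eqVneq (pt u t) (pt u w).
  have tw' : t = w := congr1 snd twE.
  split=> [->|[xu xw]]; first by split=> //; apply: Or31.
  have xw' : t <= x.2 -> x = pt u w.
    by case: x xu xw => a b /= -> bw; rewrite tw' => wb; congr pair; lra.
  case=> [xw2| |[_ [] tx]]; last by apply: xw'; rewrite tx.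
    by apply: xw'; rewrite xw2.
  by rewrite lte_fin => /ltW/xw'.
have {}ntw : 0 < w - t.
  by rewrite subr_gt0 lt_neqAle tw andbT; apply: contra ntw => /eqP ->.
have segE : segment (pt u t) (pt u w) x <-> [/\ x.1 = u, t <= x.2 & x.2 <= w].
  split=> [[r _ <-]|[<- tx xw]].
    have r0 : 0 <= r%:num by [].
    have r1 : 0 <= 1 - r%:num by rewrite subr_ge0 le1.
    have := mulr_ge0 r0 (ltW ntw); have := mulr_ge0 r1 (ltW ntw).
    rewrite /= /GRing.scale/= /unstable.onem => h1 h2; split => /=; lra.
  have r0 : 0 <= (w - x.2) / (w - t) by rewrite divr_ge0//; lra.
  have r1 : (w - x.2) / (w - t) <= 1 by rewrite ler_pdivrMr//; lra.
  exists (Itv01 r0 r1) => //; rewrite [RHS]surjective_pairing.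
  by congr pair; rewrite /= /GRing.scale/= /unstable.onem; field; lra.
have xE : x = pt u t <-> x.1 = u /\ x.2 = t.
  by split=> [->//|[<- <-]]; case: x {segE}.
case: c; rewrite ?lte_fin.
  rewrite segE; split => [[xu tx xw]|[xu xw h]]; split=> //.
    move: tx; rewrite le_eqVlt => /predU1P[->|]; first by apply: Or33.
    by move=> tx; apply: Or32.
  by case: h => [->|/ltW|[_ [->]]].
split=> [[/segE[xu tx xw] nx]|[xu xw h]].
  split => //; apply: Or32; rewrite lt_neqAle tx andbT; apply/eqP => tx'.
  by apply/nx/xE.
by split; [apply/segE; split=> //; case: h => [->|/ltW|[]]|
  move=> /xE[_ xt]; case: h => // h; lra].
Qed.

(** The left end is the infimum of [T] in the extended reals, possibly -oo, and [c] records whether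
    it is attained. Betweenness fills in everything from there up to [w]. *)
Lemma interval_with_max (T : set R) (w : R) : T w -> (forall t, T t -> t <= w) ->
  (forall r s t, T r -> T s -> r <= t -> t <= s -> T t) ->
  exists (t0 : \bar R) (c : bool), (t0 <= w%:E)%E /\
    forall t, T t <-> t <= w /\ [\/ t = w, (t0 < t%:E)%E | c /\ t0 = t%:E].
Proof.
move=> Tw Tle Tint; pose t0 := ereal_inf (EFin @` T).
have t0le t : T t -> (t0 <= t%:E)%E by move=> Tt; apply: ereal_inf_lbound; exists t.
exists t0, `[< exists2 r, t0 = r%:E & T r >]; split=> [|t]; first exact: t0le.
split=> [Tt|[tw [->//|/ereal_inf_lt[_ [s Ts <-]]|]]].
- split; first exact: Tle.
  have := t0le _ Tt; rewrite le_eqVlt => /predU1P[t0t|]; last exact: Or32.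
  by apply: Or33; split=> //; apply/asboolP; exists t.
- by rewrite lte_fin => /ltW st; apply: Tint Ts Tw _ _.
- by case=> /asboolP[r -> Tr] [<-].
Qed.

(** * Convex sets containing corners of a rectangle *)

Lemma rectangle_sub_convex K (a u b v : R) : a < u -> b < v -> convex_set K ->
  [set pt a v; pt a b; pt u b; pt u v] `<=` K ->
  forall x, a <= x.1 -> x.1 <= u -> b <= x.2 -> x.2 <= v -> K x.
Proof.
move=> au bv cK sK [x1 x2] /= ax xu bx xv.
have [Kav Kab Kub Kuv] : [/\ K (pt a v), K (pt a b), K (pt u b) & K (pt u v)].
  by split; apply: sK => /=; tauto.
by apply: (@convex_horizontal _ _ a u) => //; apply: (@convex_vertical _ _ b v).
Qed.

Lemma triangle_sub_convex K (a u b v : R) : a < u -> b < v -> convex_set K ->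
  [set pt a v; pt a b; pt u b] `<=` K ->
  forall x, a <= x.1 -> b <= x.2 ->
    (x.1 - a) / (u - a) + (x.2 - b) / (v - b) <= 1 -> K x.
Proof.
move=> au bv cK sK x ax bx h.
have [Kav Kab Kub] : [/\ K (pt a v), K (pt a b) & K (pt u b)].
  by split; apply: sK => /=; tauto.
(* Barycentric coordinates of x with respect to (u, b), (a, v) and (a, b), in this order. *)
have l0 : 0 <= (x.1 - a) / (u - a) by rewrite divr_ge0//; lra.
have m0 : 0 <= (x.2 - b) / (v - b) by rewrite divr_ge0//; lra.
have n0 : 0 <= 1 - (x.1 - a) / (u - a) - (x.2 - b) / (v - b) by lra.
have := convex_triple cK Kub Kav Kab l0 m0 n0.
have -> : (x.1 - a) / (u - a) + (x.2 - b) / (v - b)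
   + (1 - (x.1 - a) / (u - a) - (x.2 - b) / (v - b)) = 1 by ring.
move=> /(_ erefl); case: x {ax bx h l0 m0 n0} => x1 x2.
by congr (K (pt _ _)) => /=; field; lra.
Qed.

(** A proper convex combination of two points of a half-plane reaches the boundary line only if both
    points lie on it. There it dominates the smaller of the two other coordinates, so upward closed
    conditions pass to it. *)
Lemma edges_convex (u v : R) (S T : R -> Prop) :
  (forall r s, r <= s -> S r -> S s) -> (forall r s, r <= s -> T r -> T s) ->
  convex_set [set x : plane R | [/\ x.1 <= u, x.2 <= v,
                                 x.1 = u -> S x.2 & x.2 = v -> T x.1]].
Proof.
move=> upS upT.
have edge (w a b t : R) (P : R -> Prop) (c d : R) :
    (forall r s, r <= s -> P r -> P s) -> 0 < t -> t < 1 ->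
    a <= w -> b <= w -> (a = w -> P c) -> (b = w -> P d) ->
    t * a + (1 - t) * b = w -> P (t * c + (1 - t) * d).
  move=> upP t0 t1 aw bw Pc Pd tw.
  have [aE bE] : a = w /\ b = w by split; nra.
  have [cd|dc] := leP c d; first by apply: upP (Pc aE); nra.
  by apply: upP (Pd bE); nra.
apply: convex_set_open => x y t t0 t1 [x1 x2 xS xT] [y1 y2 yS yT]; split=> /=.
- nra.
- nra.
- exact: edge.
- exact: edge.
Qed.

(* The point where the ray from [z] through [y] leaves the half-line [a, +oo[,
   or [y] itself. *)
Lemma ray_exit (a y z : R) : a <= z -> exists s : R, [/\ 0 <= s, s <= 1,
  forall r, 0 <= r -> r <= s -> a <= (1 - r) * z + r * y &
  if y < a then (1 - s) * z + s * y = a else s = 1].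
Proof.
move=> az; have [ya|ay] := ltP y a; last first.
  by exists 1; split=> // r r0 r1; nra.
have zy : 0 < z - y by lra.
have s0 : 0 <= (z - a) / (z - y) by rewrite divr_ge0//; lra.
have s1 : (z - a) / (z - y) <= 1 by rewrite ler_pdivrMr//; lra.
exists ((z - a) / (z - y)); split=> //; last by field; lra.
by move=> r r0; rewrite ler_pdivlMr//; lra.
Qed.

(** * Extending a convex subset of a rectangle to the lower left *)

Section Rectangle.
Variables (K0 : set (plane R)) (alpha u beta v : R).
Hypotheses (au : alpha < u) (bv : beta < v) (cvxK0 : convex_set K0).
Hypothesis rectK0 : forall x, K0 x ->
  [/\ alpha <= x.1, x.1 <= u, beta <= x.2 & x.2 <= v].
Hypothesis triK0 : [set pt alpha v; pt alpha beta; pt u beta] `<=` K0.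

(** Follow z towards y until the ray leaves the rectangle. The exit point w is on the left or the
    bottom edge, both contained in [K0], and z lies between x and w. *)
Lemma convex_rectangle_mixed x y t : 0 <= t -> t < 1 -> K0 x ->
  y.1 <= u -> y.2 <= v -> y.1 < alpha \/ y.2 < beta ->
  let z := pt (t * x.1 + (1 - t) * y.1) (t * x.2 + (1 - t) * y.2) in
  alpha <= z.1 -> beta <= z.2 -> K0 z.
Proof.
move=> t0 t1 K0x yu yv yout z az bz.
have [x1 x2 x3 x4] := rectK0 K0x.
have zu : z.1 <= u by rewrite /z/=; nra.
have zv : z.2 <= v by rewrite /z/=; nra.
have [s [s0 s1 [w1 w2 w12]]] : exists s : R, [/\ 0 <= s, s <= 1 &
    [/\ alpha <= (1 - s) * z.1 + s * y.1, beta <= (1 - s) * z.2 + s * y.2 &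
     (1 - s) * z.1 + s * y.1 = alpha \/ (1 - s) * z.2 + s * y.2 = beta]].
  have [r [r0 r1 rP rE]] := ray_exit y.1 az.
  have [s [s0 s1 sP sE]] := ray_exit y.2 bz.
  (* Some coordinate of y is too small, so at the smaller of the two exit parameters a boundary line
     is met. *)
  have [rs|sr] := leP r s.
    exists r; split=> //; split; [exact: rP|exact: sP|].
    case: ltP rE => [_ ->|ya r1E]; first by left.
    have sr : s = r by lra.
    by case: ltP sE => [_ <-|yb]; [right; rewrite sr|lra].
  exists s; split=> //; split; [exact/rP/ltW|exact: sP|].
  case: ltP sE => [_ ->|yb s1E]; first by right.
  lra.
have K0av : K0 (pt alpha v) by apply: triK0; left; left.
have K0ab : K0 (pt alpha beta) by apply: triK0; left; right.
have K0ub : K0 (pt u beta) by apply: triK0; right.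
pose w := pt ((1 - s) * z.1 + s * y.1) ((1 - s) * z.2 + s * y.2).
have K0w : K0 w.
  have wu : w.1 <= u by rewrite /w; cbn [fst pt]; nra.
  have wv : w.2 <= v by rewrite /w; cbn [snd pt]; nra.
  rewrite [w]pt_eta; case: w12 => wE.
    rewrite [w.1]wE; exact: convex_vertical K0ab K0av _ _.
  rewrite [w.2]wE; exact: convex_horizontal K0ab K0ub _ _.
have st0 : 0 <= s * t by exact: mulr_ge0.
have d0 : 0 < 1 - t + s * t by lra.
(* Eliminating y from z = t x + (1 - t) y and w = (1 - s) z + s y gives this weight of x in z as a
   combination of x and w. *)
have r0 : 0 <= s * t / (1 - t + s * t) by rewrite divr_ge0//; lra.
have r1 : s * t / (1 - t + s * t) <= 1 by rewrite ler_pdivrMr//; lra.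
have := (convex_setP K0).1 cvxK0 _ _ _ r0 r1 K0x K0w.
by congr (K0 (pt _ _)); rewrite /w /z /=; field; lra.
Qed.

(** For two points outside the rectangle, both lie below the line through (alpha, v) and (u, beta),
    hence so does any combination; if it is in the rectangle, it is in the triangle. Mixed pairs are
    handled by [convex_rectangle_mixed]. *)
Lemma convex_rectangle_extension : convex_set [set x : plane R |
  [/\ x.1 <= u, x.2 <= v & alpha <= x.1 -> beta <= x.2 -> K0 x]].
Proof.
apply: convex_set_open => x y t t0 t1 [x1 x2 xK0] [y1 y2 yK0].
have out z : (alpha <= z.1 -> beta <= z.2 -> K0 z) ->
    K0 z \/ (z.1 < alpha \/ z.2 < beta).
  move=> h; have [az|?] := leP alpha z.1; last by right; left.
  by have [bz|?] := leP beta z.2; [left; exact: h|right; right].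
split; [rewrite /=; nra|rewrite /=; nra|].
case: (out x xK0) (out y yK0) => [K0x|xout] [K0y|yout] az bz.
- by apply: (convex_setP K0).1 => //; exact: ltW.
- exact: convex_rectangle_mixed (ltW t0) t1 K0x y1 y2 yout az bz.
- have t0' : 0 <= 1 - t by lra.
  have t1' : 1 - t < 1 by lra.
  have := convex_rectangle_mixed t0' t1' K0y x1 x2 xout.
  by rewrite subKr ![(1 - t) * _ + _]addrC; apply.
- apply: triangle_sub_convex au bv cvxK0 triK0 _ az bz _ => /=.
  have below z : z.1 <= u -> z.2 <= v -> z.1 < alpha \/ z.2 < beta ->
      (z.1 - alpha) / (u - alpha) + (z.2 - beta) / (v - beta) <= 1.
    move=> zu zv zout.
    have a1 : (z.1 - alpha) / (u - alpha) <= 1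
      by rewrite ler_pdivrMr ?subr_gt0// mul1r lerD2r.
    have b1 : (z.2 - beta) / (v - beta) <= 1
      by rewrite ler_pdivrMr ?subr_gt0// mul1r lerD2r.
    case: zout => h.
      have : (z.1 - alpha) / (u - alpha) <= 0
        by rewrite ler_pdivrMr ?subr_gt0// mul0r subr_le0 ltW.
      lra.
    have : (z.2 - beta) / (v - beta) <= 0
        by rewrite ler_pdivrMr ?subr_gt0// mul0r subr_le0 ltW.
    lra.
  have := below x x1 x2 xout; have := below y y1 y2 yout.
  move=> hy hx.
  rewrite [leLHS](_ : _ = t * ((x.1 - alpha) / (u - alpha) + (x.2 - beta) / (v - beta)) +
     (1 - t) * ((y.1 - alpha) / (u - alpha) + (y.2 - beta) / (v - beta))); last first.
    by field; rewrite !subr_eq0 !gt_eqF.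
  nra.
Qed.

End Rectangle.

End Plane.

(** * The q-topology in terms of coordinates *)

Section AsymmetricNorm.
Variables (R : realType) (q : plane R -> R).
Hypothesis hq : asym_lattice_norm q.

Lemma asym_normD x y : q (x + y) <= q x + q y.
Proof.
have [N hN qE] := hq; rewrite !qE.
apply: le_trans (ler_lattice_normD hN _ _).
have max_addr (a b : R) :
    `|Num.max (a + b) 0| <= `|Num.max a 0 + Num.max b 0|.
  rewrite !ger0_norm ?addr_ge0 ?le_max ?lexx ?orbT// ge_max.
  by rewrite lerD ?le_max ?lexx// addr_ge0 ?le_max ?lexx ?orbT.
by apply: ler_lattice_norm => //=; exact: max_addr.
Qed.

(** By monotonicity of N, the positive part of x is bounded above by m (1, 1), with m its largest
    coordinate, and below by its projections to the axes. Hence C = N (1, 1), and c is the smaller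
    of N (1, 0) and N (0, 1). *)
Lemma asym_norm_bounds : exists c C : R, [/\ 0 < c, 0 < C,
  forall (x : plane R) e, 0 < e -> x.1 < e -> x.2 < e -> q x < C * e &
  forall (x : plane R) e, 0 <= e -> q x < c * e -> x.1 < e /\ x.2 < e].
Proof.
have [N hN qE] := hq.
have N0 : N 0 = 0 by rewrite -(scale0r 0) (lattice_normZ hN) normr0 mul0r.
have N_gt0 x : x != 0 -> 0 < N x.
  move=> x0; rewrite lt_neqAle; apply/andP; split.
    by apply: contra x0 => /eqP Nx; apply/eqP; exact: (lattice_norm_eq0 hN).
  have := ler_lattice_normD hN x (- x).
  rewrite subrr N0 -scaleN1r (lattice_normZ hN) normrN1 mul1r.
  by rewrite -mulr2n pmulrn_lge0.
have NZ a x : 0 <= a -> N (a *: x) = a * N x.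
  by move=> a0; rewrite (lattice_normZ hN) ger0_norm.
have e1 : 0 < N (pt 1 0).
  by apply: N_gt0; apply/eqP => -[/eqP]; rewrite oner_eq0.
have e2 : 0 < N (pt 0 1).
  by apply: N_gt0; apply/eqP => -[/eqP]; rewrite oner_eq0.
have e12 : 0 < N (pt 1 1).
  by apply: N_gt0; apply/eqP => -[/eqP]; rewrite oner_eq0.
have N1E a : a *: pt 1 0 = pt a 0 :> plane R.
  by congr pair; rewrite /= /GRing.scale/= ?mulr1 ?mulr0.
have N2E a : a *: pt 0 1 = pt 0 a :> plane R.
  by congr pair; rewrite /= /GRing.scale/= ?mulr1 ?mulr0.
have N12E a : a *: pt 1 1 = pt a a :> plane R.
  by congr pair; rewrite /= /GRing.scale/= ?mulr1.
have absmax (a : R) : `|Num.max a 0| = Num.max a 0.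
  by rewrite ger0_norm// le_max lexx orbT.
exists (Num.min (N (pt 1 0)) (N (pt 0 1))), (N (pt 1 1)).
split; rewrite ?lt_min ?e1//.
- move=> x e e0 x1 x2; rewrite qE.
  set m := Num.max (Num.max x.1 x.2) 0.
  have me : m < e by rewrite !gt_max x1 x2 e0.
  have m0 : 0 <= m by rewrite le_max lexx orbT.
  apply: (@le_lt_trans _ _ (N (m *: pt 1 1))); last first.
    by rewrite NZ// mulrC ltr_pM2l.
  rewrite N12E; apply: (ler_lattice_norm hN) => /=; rewrite absmax (ger0_norm m0);
  by rewrite /m !ge_max !le_max !lexx ?orbT.
- move=> x e eg0 h.
  have main (a b f : R) (z : plane R) : 0 < N z -> q x < f * e -> f <= N z ->
      N (Num.max a 0 *: z) <= q x -> a < e.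
    move=> z0 xf fz zx; rewrite ltNge; apply/negP => ea.
    have : N (Num.max a 0 *: z) < N z * e.
      by apply: le_lt_trans zx _; apply: lt_le_trans xf _; exact: ler_wpM2r.
    rewrite NZ ?le_max ?lexx ?orbT// mulrC ltr_pM2l//.
    by rewrite gt_max ltNge ea.
  split; [apply: (main _ 0 _ (pt 1 0) e1 h)|apply: (main _ 0 _ (pt 0 1) e2 h)];
   rewrite ?ge_min ?lexx ?orbT// qE ?N1E ?N2E;
   by apply: (ler_lattice_norm hN); rewrite /= ?normr0.
Qed.

Lemma asym_norm0 : q 0 = 0.
Proof.
have [N hN ->] := hq.
rewrite /pos_part /= maxxx (_ : pt 0 0 = 0 :> plane R)//.
by rewrite -(scale0r 0) (lattice_normZ hN) normr0 mul0r.
Qed.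

Lemma theta0P x : theta0 q x <-> x.1 <= 0 /\ x.2 <= 0.
Proof.
split=> [qx|[x1 x2]].
  have [c [C [c0 _ _ qlt]]] := asym_norm_bounds.
  suff lt_eps e : 0 < e -> x.1 < e /\ x.2 < e.
    by split; apply/ler_addgt0Pr => e /lt_eps[]; rewrite add0r => *; exact: ltW.
  by move=> e0; apply: qlt (ltW e0) _; rewrite qx mulr_gt0.
have [N _ qE] := hq; rewrite /theta0/= -asym_norm0 !qE; congr N.
by rewrite /pos_part/= maxxx !max_r.
Qed.

(** By [asym_norm_bounds] each ball lies between two open quadrants whose corners are strictly above
    its centre. *)
Lemma qopenP (U : set (plane R)) :
  open (U : set (qplane q)) <-> forall x, U x -> exists2 d, 0 < d &
    forall y : plane R, y.1 < x.1 + d -> y.2 < x.2 + d -> U y.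
Proof.
have [c [C [c0 C0 ltq qlt]]] := asym_norm_bounds.
split=> [/(openP_qball asym_norm0 asym_normD) oU x /oU[e e0 sU]|oU].
  exists (e / C) => [|y y1 y2]; first by rewrite divr_gt0.
  apply: sU; rewrite /qball/=; have -> : e = C * (e / C).
    by rewrite mulrC divfK ?gt_eqF.
  by apply: ltq; rewrite ?divr_gt0//= ltrBlDl.
apply/(openP_qball asym_norm0 asym_normD) => x /oU[d d0 sU].
exists (c * d) => [|y /qlt]; first by rewrite mulr_gt0.
by rewrite ltW// => -[]//= y1 y2; apply: sU; rewrite -ltrBlDl.
Qed.

Lemma sym_normD x y : sym_norm q (x + y) <= sym_norm q x + sym_norm q y.
Proof.
rewrite /sym_norm ge_max opprD; apply/andP; split;
  by apply: le_trans (asym_normD _ _) _; rewrite lerD ?le_max ?lexx ?orbT.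
Qed.

Lemma sym_norm0 : sym_norm q 0 = 0.
Proof. by rewrite /sym_norm oppr0 maxxx asym_norm0. Qed.

Lemma qopen_sopen (U : set (plane R)) :
  open (U : set (qplane q)) -> open (U : set (qplane (sym_norm q))).
Proof.
move=> /(openP_qball asym_norm0 asym_normD) oU.
apply/(openP_qball sym_norm0 sym_normD) => x /oU[e e0 sU].
by exists e => // y; rewrite /qball/= gt_max => /andP[ye _]; exact: sU.
Qed.

Lemma sopen_open (U : set (plane R)) :
  open (U : set (qplane (sym_norm q))) -> open (U : set (R^o * R^o)%type).
Proof.
have [c [C [c0 C0 ltq qlt]]] := asym_norm_bounds.
move=> /(openP_qball sym_norm0 sym_normD) oU.
rewrite openE => x /oU[e e0 sU]; apply/nbhs_ballP.
have eC : 0 < e / C by rewrite divr_gt0.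
exists (e / C) => //= y [/= y1 y2]; apply: sU; rewrite /qball/= gt_max.
have -> : e = C * (e / C) by rewrite mulrC divfK ?gt_eqF.
move: y1 y2; rewrite /ball/= => /ltr_normlP[y1 y1'] /ltr_normlP[y2 y2'].
by apply/andP; split; apply: ltq => //=; rewrite ?opprB//; move: y1 y1' y2 y2'; lra.
Qed.

(** * Maxima on q-compact sets, and q-compactness by domination *)

(** If no such k existed, the sets [U (f y)] would cover [K]. In a finite subcover the one with the
    largest [f y] contains all others, hence y itself, against [UN]. Strict sublevel sets as [U]
    yield maximum points. *)
Lemma qcompact_exists_max (K D : set (plane R)) (f : plane R -> R)
    (U : R -> set (plane R)) :
  qcompact q K -> D !=set0 -> D `<=` K ->
  (forall r, open (U r : set (qplane q))) ->
  (forall r s, r <= s -> U r `<=` U s) ->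
  (forall y, D y -> ~ U (f y) y) ->
  exists2 k, K k & forall y, D y -> ~ U (f y) k.
Proof.
move=> cK [y0 Dy0] DK oU leU UN; apply: contrapT => noK.
have KU : K `<=` cover (D : set (qplane q)) (U \o f).
  move=> k Kk; apply: contrapT => kU; apply: noK; exists k => // y Dy Uk.
  by apply: kU; exists y.
have [F FD KF] := cK _ D (U \o f) (fun i _ => oU (f i)) KU.
have [y Fy ymax] : exists2 y, y \in enum_fset F &
    forall z, z \in enum_fset F -> f z <= f y.
  have [y Fy _] := KF _ (DK _ Dy0).
  have : y \in enum_fset F by exact: Fy.
  elim: (enum_fset F) y {Fy} => // z s IH y _.
  case: s IH => [|z' s] IH; first by exists z; rewrite ?inE// => w /[!inE]/eqP->.
  have [|w ws wmax] := IH z'; first by rewrite inE eqxx.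
  have [zw|wz] := leP (f z) (f w).
    by exists w => [|t]; rewrite inE ?ws ?orbT// => /predU1P[->//|/wmax].
  exists z => [|t]; rewrite inE ?eqxx// => /predU1P[->//|/wmax tw].
  exact: le_trans tw (ltW wz).
have Dy : D y by apply/set_mem/FD.
have [z Fz Uz] := KF _ (DK _ Dy).
by apply: UN Dy _; apply: leU Uz; exact: ymax.
Qed.

Lemma qopen_quadrant (a b : R) :
  open ([set x | x.1 < a /\ x.2 < b] : set (qplane q)).
Proof.
apply/qopenP => x [x1 x2].
exists (Num.min (a - x.1) (b - x.2)); first by rewrite lt_min !subr_gt0 x1.
move=> y y1 y2; have := lexx (Num.min (a - x.1) (b - x.2)).
by rewrite le_min => /andP[m1 m2]; split; lra.
Qed.

Lemma translate_qinterior_theta0 (a b : R) :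
  translate (pt a b) (qinterior q (theta0 q)) = [set x | x.1 < a /\ x.2 < b].
Proof.
have -> : qinterior q (theta0 q) = [set x | x.1 < 0 /\ x.2 < 0].
  apply/seteqP; split => x.
    rewrite /qinterior/interior/= nbhsE => -[U [oU Ux] sU].
    have [d d0 dU] := (qopenP U).1 oU x Ux.
    (* An interior point can be raised by d / 2 within [theta0], so its coordinates are negative. *)
    have /sU/theta0P/=[h1 h2] : U (pt (x.1 + d / 2) (x.2 + d / 2)).
      by apply: dU => /=; lra.
    by move: h1 h2; split; lra.
  move=> x0; rewrite /qinterior/interior/= nbhsE.
  exists [set x : plane R | x.1 < 0 /\ x.2 < 0] => //.
    by split=> //; exact: qopen_quadrant.
  by move=> y [y1 y2]; apply/theta0P; split; exact: ltW.
apply/seteqP; split => [_ [y [y1 y2] <-] /=|x [/= x1 x2]].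
  by split; [change (a + y.1 < a)|change (b + y.2 < b)]; lra.
exists (x - pt a b); last by rewrite addrC subrK.
by split; [change (x.1 - a < 0)|change (x.2 - b < 0)]; lra.
Qed.

(** A q-open set contains everything below each of its points, so a finite subfamily that covers
    [K0] covers [K]. *)
Lemma qcompact_dominated (K0 K : set (plane R)) :
  qcompact (sym_norm q) K0 -> K0 `<=` K ->
  (forall x, K x -> exists2 y, K0 y & x.1 <= y.1 /\ x.2 <= y.2) ->
  qcompact q K.
Proof.
move=> cK0 K0K KK0 I D f oU KU.
have [i Di|F FD K0F] := cK0 I D f _ (subset_trans K0K KU).
  exact/qopen_sopen/oU.
exists F => // x /KK0[y /K0F[i Fi Uy] [xy1 xy2]]; exists i => //.
have Di : D i by apply/set_mem/FD.
have [d d0 sU] := (qopenP (f i)).1 (oU i Di) y Uy.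
by apply: sU; [apply: le_lt_trans xy1 _|apply: le_lt_trans xy2 _]; rewrite ltrDl.
Qed.

(** A one-sided Lipschitz condition that makes strict sublevel sets q-open; the coordinates satisfy
    it. *)
Definition upper_lipschitz (f : plane R -> R) := forall x y d,
  y.1 < x.1 + d -> y.2 < x.2 + d -> f y < f x + d.

Lemma qopen_or_lt (f g : plane R -> R) (r s : R) :
  upper_lipschitz f ->
  upper_lipschitz g ->
  open ([set x | f x < r \/ g x < s] : set (qplane q)).
Proof.
move=> hf hg; apply/qopenP => x [h|h].
  exists (r - f x) => [|y y1 y2]; first by rewrite subr_gt0.
  by left; have := hf _ _ _ y1 y2; rewrite subrKC.
exists (s - g x) => [|y y1 y2]; first by rewrite subr_gt0.
by right; have := hg _ _ _ y1 y2; rewrite subrKC.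
Qed.

(** First f is maximized at m, then g on the level set of [f m]. In the second stage the open set
    where f < f m joins the sublevel sets of g, which forces k onto that level set. *)
Lemma qcompact_lexi_max (f g : plane R -> R) (K : set (plane R)) :
  upper_lipschitz f ->
  upper_lipschitz g ->
  qcompact q K -> K !=set0 ->
  exists2 k, K k & forall x, K x -> f x <= f k /\ (f x = f k -> g x <= g k).
Proof.
move=> hf hg cK K0.
have [m Km mP] := @qcompact_exists_max K K f (fun r => [set x | f x < r \/ f x < r])
  cK K0 (fun x => id) (fun r => qopen_or_lt _ _ hf hf)
  (fun r s rs => ltac:(by move=> x /= [] /lt_le_trans/(_ rs); left))
  (fun y _ => ltac:(by rewrite /= ltxx; case)).
have {}mP x : K x -> f x <= f m.
  by move=> /mP h; rewrite leNgt; apply/negP => ?; apply: h; left.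
have [k Kk kP] := @qcompact_exists_max K [set x | K x /\ f x = f m] g
  (fun r => [set x | f x < f m \/ g x < r]) cK (ex_intro _ m (conj Km erefl))
  (fun x => @proj1 _ _) (fun r => qopen_or_lt _ _ hf hg)
  (fun r s rs => ltac:(by move=> x /= [|/lt_le_trans/(_ rs)]; [left|right]))
  (fun y Dy => ltac:(by case: Dy => _ yfm; rewrite /= yfm !ltxx; case)).
have fk : f k = f m.
  apply/eqP; rewrite eq_le mP//= leNgt; apply/negP => h.
  by apply: (kP m) => //; left.
exists k => // x Kx; rewrite fk; split=> [|fx]; first exact: mP.
by rewrite leNgt; apply/negP => ?; apply: (kP x) => //; right.
Qed.

(** A maximum point k of the smaller of x.1 - z.1 and x.2 - z.2 lies above z: were the maximum
    negative, a point of [K] closer to z would exceed it. *)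
Lemma qcompact_limit_below (K : set (plane R)) (z : plane R) : qcompact q K ->
  (forall e, 0 < e -> exists2 x, K x & z.1 - e < x.1 /\ z.2 - e < x.2) ->
  exists2 k, K k & z.1 <= k.1 /\ z.2 <= k.2.
Proof.
move=> cK hz.
pose f (x : plane R) := Num.min (x.1 - z.1) (x.2 - z.2).
have fP : upper_lipschitz f.
  move=> x y d y1 y2; rewrite /f -ltrBlDr lt_min !ltrBlDr.
  by rewrite !gt_min; apply/andP; split; apply/orP; [left|right]; lra.
have K0 : K !=set0 by have [//|x Kx _] := hz 1; exists x.
have [k Kk kP] := qcompact_lexi_max fP fP cK K0.
suff : 0 <= f k by rewrite le_min !subr_ge0 => /andP[]; exists k.
rewrite leNgt; apply/negP => fk.
have [|x Kx [x1 x2]] := hz (- f k); first by rewrite oppr_gt0.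
have := (kP x Kx).1; rewrite leNgt => /negP; apply.
by rewrite {2}/f lt_min; apply/andP; split; lra.
Qed.

Lemma qinterior_below (K : set (plane R)) : qinterior q K !=set0 ->
  exists a b : R, forall y : plane R, y.1 < a -> y.2 < b -> K y.
Proof.
move=> [x]; rewrite /qinterior/interior/= nbhsE => -[U [oU Ux] sU].
have [d d0 dU] := (qopenP U).1 oU x Ux.
by exists (x.1 + d), (x.2 + d) => y y1 y2; exact/sU/dU.
Qed.

Lemma compact_qcompact_sym (K : set (plane R)) :
  compact (K : set (R^o * R^o)%type) -> qcompact (sym_norm q) K.
Proof.
move=> cK; have {}cK : cover_compact (K : set (R^o * R^o)%type).
  pose T : ptopologicalType := HB.pack (R^o * R^o)%type
    (isPointed.Build (R^o * R^o)%type (point, point)).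
  by have := @compact_cover T =>  /(congr1 (fun P => P K)) <-.
move=> I D f oU KU.
exact: cK (fun i Di => sopen_open (oU i Di)) KU.
Qed.

(** * From a q-compact convex body to its description *)

Section ConvexBody.
Variable K : set (plane R).
Hypotheses (cvxK : convex_set K) (cK : qcompact q K).
Hypothesis intK : qinterior q K !=set0.

Lemma body_neq0 : K !=set0.
Proof. by have [x /interior_subset Kx] := intK; exists x. Qed.

(** The ray from k through z ends up in the quadrant contained in [K], so z lies between k and a
    point of [K]. *)
Lemma body_strict_below (k z : plane R) :
  K k -> z.1 < k.1 -> z.2 < k.2 -> K z.
Proof.
have [a [b abK]] := qinterior_below intK => Kk z1 z2.
(* Each summand alone carries one coordinate of z - M (k - z) below a or b; the sum serves both. *)
pose M := (`|z.1 - a| + 1) / (k.1 - z.1) + (`|z.2 - b| + 1) / (k.2 - z.2).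
have M1 : (`|z.1 - a| + 1) / (k.1 - z.1) <= M.
  by rewrite lerDl divr_ge0 ?subr_ge0 ?(ltW z1) ?(ltW z2) ?addr_ge0//.
have M2 : (`|z.2 - b| + 1) / (k.2 - z.2) <= M.
  by rewrite lerDr divr_ge0 ?subr_ge0 ?(ltW z1) ?(ltW z2) ?addr_ge0//.
have M0 : 0 <= M.
  apply: le_trans M1.
  by rewrite divr_ge0 ?subr_ge0 ?(ltW z1) ?(ltW z2) ?addr_ge0//.
rewrite ler_pdivrMr ?subr_gt0// in M1; rewrite ler_pdivrMr ?subr_gt0// in M2.
have Ky : K (pt (z.1 - M * (k.1 - z.1)) (z.2 - M * (k.2 - z.2))).
  by apply: abK => /=; [have := ler_norm (z.1 - a)|have := ler_norm (z.2 - b)];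
    lra.
have M1' : 0 < 1 + M by lra.
have t0 : 0 <= M / (1 + M) by rewrite divr_ge0//; lra.
have t1 : M / (1 + M) <= 1 by rewrite ler_pdivrMr//; lra.
have := (convex_setP K).1 cvxK _ _ _ t0 t1 Kk Ky.
by rewrite [X in _ -> K X]pt_eta; congr (K (pt _ _)) => /=; field; lra.
Qed.

(** Lexicographic maxima for the two orders of the coordinates. *)
Lemma body_corners : exists u v alpha beta : R,
  [/\ K (pt u beta), K (pt alpha v),
      forall x, K x -> x.1 <= u /\ x.2 <= v,
      forall t, K (pt u t) -> t <= beta & forall s, K (pt s v) -> s <= alpha].
Proof.
have l1 : upper_lipschitz fst by [].
have l2 : upper_lipschitz snd by [].
have [[u beta] Kub ubP] := qcompact_lexi_max l1 l2 cK body_neq0.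
have [[alpha v] Kav avP] := qcompact_lexi_max l2 l1 cK body_neq0.
exists u, v, alpha, beta; split=> // [x Kx|t Kt|s Ks].
- by split; [have [] := ubP x Kx|have [] := avP x Kx].
- by have [_] := ubP _ Kt; apply.
- by have [_] := avP _ Ks; apply.
Qed.

Lemma body_edges (u v alpha beta : R) : K (pt u beta) -> K (pt alpha v) ->
  (forall t, K (pt u t) -> t <= beta) -> (forall s, K (pt s v) -> s <= alpha) ->
  exists (t0 s0 : \bar R) (c d : bool),
    [/\ (t0 <= beta%:E)%E, (s0 <= alpha%:E)%E,
        forall x, vsegment c u t0 beta x <-> x.1 = u /\ K x &
        forall x, hsegment d s0 v alpha x <-> x.2 = v /\ K x].
Proof.
move=> Kub Kav betaP alphaP.
have [t0 [c [t0b TP]]] := interval_with_max (T := fun t => K (pt u t)) Kub betaP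
  (fun r s t Kr Ks rt ts => convex_vertical cvxK Kr Ks rt ts).
have [s0 [d [s0a SP]]] := interval_with_max (T := fun s => K (pt s v)) Kav alphaP
  (fun r s t Kr Ks rt ts => convex_horizontal cvxK Kr Ks rt ts).
exists t0, s0, c, d; split=> // -[x y]; rewrite ?hsegmentE vsegmentE//=.
  split=> [[-> yb h]|[-> /TP[]]//].
  by split=> //; apply/TP.
split=> [[-> yb h]|[-> /SP[]]//].
by split=> //; apply/SP.
Qed.

Lemma body_corner_form (u v : R) : K (pt u v) ->
  (forall x, K x -> x.1 <= u /\ x.2 <= v) ->
  exists (t0 s0 : \bar R) (c d : bool),
  [/\ (t0 <= v%:E)%E, (s0 <= u%:E)%E &
      K = vsegment c u t0 v `|` hsegment d s0 v u
          `|` translate (pt u v) (qinterior q (theta0 q))].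
Proof.
move=> Kuv Kle.
have [t0 [s0 [c [d [t0v s0u vP hP]]]]] := body_edges Kuv Kuv
  (fun t Kt => (Kle _ Kt).2) (fun s Ks => (Kle _ Ks).1).
exists t0, s0, c, d; split=> //; rewrite translate_qinterior_theta0.
apply/seteqP; split=> x.
  move=> Kx; have [x1 x2] := Kle x Kx.
  move: x1; rewrite le_eqVlt => /predU1P[x1|x1]; first by left; left; apply/vP.
  move: x2; rewrite le_eqVlt => /predU1P[x2|x2]; last by right.
  by left; right; apply/hP.
by case=> [[/vP[]|/hP[]]//|[x1 x2]]; exact: body_strict_below Kuv x1 x2.
Qed.

Lemma body_rectangle_form (u v alpha beta : R) : ~ K (pt u v) ->
  K (pt u beta) -> K (pt alpha v) -> (forall x, K x -> x.1 <= u /\ x.2 <= v) ->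
  (forall t, K (pt u t) -> t <= beta) -> (forall s, K (pt s v) -> s <= alpha) ->
  exists (s0 t0 : \bar R) (c d : bool) (K0 : set (plane R)),
     [/\ alpha < u, beta < v, (s0 <= alpha%:E)%E & (t0 <= beta%:E)%E] /\
     [/\ qcompact (sym_norm q) K0, convex_set K0,
         convex_hull [set pt alpha v; pt alpha beta; pt u beta] `<=` K0 &
         K0 `<=` convex_hull
                   [set pt alpha v; pt alpha beta; pt u beta; pt u v]] /\
     [/\ K0 `<=` K, K `<=` sumset K0 (theta0 q) &
       K = K0 `|` translate (pt alpha v) (qinterior q (theta0 q))
              `|` translate (pt u beta) (qinterior q (theta0 q))
              `|` vsegment c u t0 beta `|` hsegment d s0 v alpha].
Proof.
move=> nKuv Kub Kav Kle betaP alphaP.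
have au : alpha < u.
  rewrite lt_neqAle (Kle _ Kav).1 andbT; apply/eqP => au.
  by apply: nKuv; rewrite -au.
have bv : beta < v.
  rewrite lt_neqAle (Kle _ Kub).2 andbT; apply/eqP => bv.
  by apply: nKuv; rewrite -bv.
have [t0 [s0 [c [d [t0b s0a vP hP]]]]] := body_edges Kub Kav betaP alphaP.
(* Away from the lines x.1 = u and x.2 = v, [K] is closed downwards. If z shares a coordinate with
   k, a point of the common line far enough down or left is strictly below (u, beta) or (alpha, v),
   and z is between it and k. *)
have below (k z : plane R) : K k -> z.1 <= k.1 -> z.2 <= k.2 ->
    z.1 < u -> z.2 < v -> K z.
  case: k z => k1 k2 [z1 z2] /= Kk zk1 zk2 zu zv.
  have [zk1'|zk1'] := eqVneq z1 k1.
    have [m1 m2] : Num.min z2 beta <= z2 /\ Num.min z2 beta <= beta.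
      by split; rewrite ge_min lexx ?orbT.
    apply: (@convex_vertical _ _ _ (Num.min z2 beta - 1) k2) => //;
      [|by rewrite zk1'|lra].
    by apply: body_strict_below Kub _ _ => //=; lra.
  have [zk2'|zk2'] := eqVneq z2 k2.
    have [m1 m2] : Num.min z1 alpha <= z1 /\ Num.min z1 alpha <= alpha.
      by split; rewrite ge_min lexx ?orbT.
    apply: (@convex_horizontal _ _ _ (Num.min z1 alpha - 1) k1) => //;
      [|by rewrite zk2'|lra].
    by apply: body_strict_below Kav _ _ => //=; lra.
  by apply: body_strict_below Kk _ _; rewrite /= lt_neqAle ?zk1' ?zk2'.
pose K0 := [set x : plane R | [/\ K x, alpha <= x.1 & beta <= x.2]].
have K0E x : K x -> alpha <= x.1 -> beta <= x.2 -> K0 x by [].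
have cvxK0 : convex_set K0.
  apply/convex_setP => x y t t0' t1 [Kx x1 x2] [Ky y1 y2]; apply: K0E => /=.
  - exact: (convex_setP K).1.
  - nra.
  - nra.
have K0ub : K0 (pt u beta) by apply: K0E => //=; exact: ltW.
have K0av : K0 (pt alpha v) by apply: K0E => //=; exact: ltW.
have K0ab : K0 (pt alpha beta).
  by apply: K0E => //=; apply: below Kub _ _ _ _ => //=; exact: ltW.
(* A point of [K] outside [K0] lies below (alpha, v) or (u, beta). *)
have K0_above x : K x -> exists2 y, K0 y & x.1 <= y.1 /\ x.2 <= y.2.
  move=> Kx; have [x1 x2] := Kle x Kx.
  have [ax|/ltW xa] := leP alpha x.1; last by exists (pt alpha v).
  have [bx|/ltW xb] := leP beta x.2; last by exists (pt u beta).
  by exists x.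
exists s0, t0, c, d, K0; split=> //; split; split.
(* [K0] is a closed subset of a compact box: a limit z of its points is below some k in [K], so
   [below] applies unless z is on the line x.1 = u or x.2 = v. *)
- apply: compact_qcompact_sym.
  pose box := (`[alpha, u] `*` `[beta, v])%classic : set (R^o * R^o)%type.
  have cbox : compact box by apply: compact_setX; exact: segment_compact.
  apply: (subclosed_compact _ cbox) => [z clz|x [Kx x1 x2]]; last first.
    by have [? ?] := Kle x Kx; split; rewrite /= in_itv/= ?x1 ?x2.
  have near e : 0 < e -> exists2 x, K0 x & [/\ z.1 - e < x.1, x.1 < z.1 + e,
      z.2 - e < x.2 & x.2 < z.2 + e].
    move=> e0; have [|x [Kx [/= x1 x2]]] := clz (ball z e).
      exact: nbhsx_ballx.
    exists x => //; move: x1 x2; rewrite /ball/= => /ltr_normlP[x1 x1'].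
    by move=> /ltr_normlP[x2 x2']; split; lra.
  have [z1 z2] : alpha <= z.1 /\ beta <= z.2.
    by split; apply/ler_addgt0Pr => e /near[x [_ x1 x2] []]; lra.
  have [k Kk [zk1 zk2]] : exists2 k, K k & z.1 <= k.1 /\ z.2 <= k.2.
    apply: qcompact_limit_below => // e /near[x [Kx _ _] [? _ ? _]].
    by exists x.
  apply: K0E => //; have [k1 k2] := Kle k Kk.
  (* If z.1 = u, then k.1 = u, so z.2 <= k.2 <= beta and z is the corner (u, beta); the top line is
     symmetric. *)
  have [zu|uz] := ltP z.1 u; last first.
    have ku : k.1 = u by lra.
    have kb : k.2 <= beta by apply: betaP; rewrite -ku; case: k Kk {zk1 zk2 k1 k2 ku}.
    by rewrite (_ : z = pt u beta)// [LHS]pt_eta; congr pair; lra.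
  have [zv|vz] := ltP z.2 v; first exact: below Kk _ _ _ _.
  have kv : k.2 = v by lra.
  have ka : k.1 <= alpha by apply: alphaP; rewrite -kv; case: k Kk {zk1 zk2 k1 k2 kv}.
  by rewrite (_ : z = pt alpha v)// [LHS]pt_eta; congr pair; lra.
- by [].
- by apply: smallest_sub => // x [[]|] ->.
- move=> x [Kx x1 x2] M [cM sM]; have [xu xv] := Kle x Kx.
  exact: rectangle_sub_convex au bv cM sM _ x1 xu x2 xv.
- by move=> x [].
- move=> x /K0_above[y K0y [xy1 xy2]]; exists y => //; exists (x - y).
    by apply/theta0P; split; rewrite /= subr_le0.
  by rewrite addrC subrK.
- rewrite !translate_qinterior_theta0; apply/seteqP; split=> x.
    move=> Kx; have [x1 x2] := Kle x Kx.
    have [ax|xa] := leP alpha x.1; last first.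
      move: x2; rewrite le_eqVlt => /predU1P[x2|x2]; first by right; apply/hP.
      by do 3 left; right.
    have [bx|xb] := leP beta x.2; first by do 4 left.
    move: x1; rewrite le_eqVlt => /predU1P[x1|x1]; first by left; right; apply/vP.
    by left; left; right.
  case=> [[[[[]//|[x1 x2]]|[x1 x2]]|/vP[]//]|/hP[]//].
    exact: body_strict_below Kav x1 x2.
  exact: body_strict_below Kub x1 x2.
Qed.

End ConvexBody.

(** * Sets of the two forms are q-compact convex bodies *)

Lemma qinterior_neq0 (K : set (plane R)) (a b : R) :
  (forall x : plane R, x.1 < a -> x.2 < b -> K x) -> qinterior q K !=set0.
Proof.
move=> abK; exists (pt (a - 1) (b - 1)); rewrite /qinterior/interior/= nbhsE.
exists [set x : plane R | x.1 < a /\ x.2 < b]; last by move=> x [/abK]; apply.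
by split=> /=; [exact: qopen_quadrant|split; lra].
Qed.

(** The condition of [vsegmentE] without its upper bound, hence upward closed as [edges_convex]
    requires. *)
Let edge (t0 : \bar R) (c : bool) (w t : R) :=
  [\/ t = w, (t0 < t%:E)%E | c /\ t0 = t%:E].

Let edge_up (t0 : \bar R) c (w : R) : (t0 <= w%:E)%E ->
  forall r s, r <= s -> edge t0 c w r -> edge t0 c w s.
Proof.
move=> t0w r s; rewrite le_eqVlt => /predU1P[->//|rs].
have rs' : (r%:E < s%:E)%E by rewrite lte_fin.
case=> [rw|t0r|[_ t0r]]; apply: Or32.
- by apply: le_lt_trans t0w _; rewrite -rw.
- exact: lt_trans t0r rs'.
- by rewrite t0r.
Qed.

(** The set is an instance of [edges_convex], and all its points lie below the single point (u,
    v). *)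
Lemma corner_form_body (u v : R) (t0 s0 : \bar R) (c d : bool) :
  (t0 <= v%:E)%E -> (s0 <= u%:E)%E ->
  qcompact_convex_body q (vsegment c u t0 v `|` hsegment d s0 v u
    `|` translate (pt u v) (qinterior q (theta0 q))).
Proof.
move=> t0v s0u; rewrite translate_qinterior_theta0; set K := (X in _ _ X).
have KE : K = [set x | [/\ x.1 <= u, x.2 <= v, x.1 = u -> edge t0 c v x.2 &
                           x.2 = v -> edge s0 d u x.1]].
  apply/seteqP; split=> x.
    case=> [[/(vsegmentE _ _ _ t0v)[xu xv h]|
             /hsegmentE/(vsegmentE _ _ _ s0u)/=[xv xu h]]|[x1 x2]]; split=> //.
    - by rewrite xu.
    - by move=> _; rewrite xu; apply: Or31.
    - by rewrite xv.
    - by move=> _; rewrite xv; apply: Or31.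
    - exact: ltW.
    - exact: ltW.
    - by move=> xu; rewrite xu ltxx in x1.
    - by move=> xv; rewrite xv ltxx in x2.
  move=> [x1 x2 xt xs].
  move: (x1); rewrite le_eqVlt => /predU1P[xu|xu].
    by left; left; apply/vsegmentE => //; split=> //; exact: xt.
  move: (x2); rewrite le_eqVlt => /predU1P[xv|xv]; last by right.
  by left; right; apply/hsegmentE/vsegmentE => //; split=> //; exact: xs.
have Kuv : K (pt u v) by rewrite KE; split=> //= _; apply: Or31.
split.
- by rewrite KE; apply: edges_convex; exact: edge_up.
- apply: (@qcompact_dominated [set pt u v]) => [|x ->//|x].
    exact/compact_qcompact_sym/compact_set1.
  by rewrite KE => -[x1 x2 _ _]; exists (pt u v).
- by apply: (@qinterior_neq0 _ u v) => x x1 x2; right.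
Qed.

(** [K] is the intersection of two convex sets: that of [edges_convex] prescribes the traces on the
    lines x.1 = u and x.2 = v, that of [convex_rectangle_extension] the part in the rectangle. It is
    dominated by [K0] because it lies in [K0] + [theta0]. *)
Lemma rectangle_form_body (alpha u beta v : R) (s0 t0 : \bar R) (c d : bool)
    (K0 K : set (plane R)) :
  [/\ alpha < u, beta < v, (s0 <= alpha%:E)%E & (t0 <= beta%:E)%E] ->
  [/\ qcompact (sym_norm q) K0, convex_set K0,
      convex_hull [set pt alpha v; pt alpha beta; pt u beta] `<=` K0 &
      K0 `<=` convex_hull
                [set pt alpha v; pt alpha beta; pt u beta; pt u v]] ->
  [/\ K0 `<=` K, K `<=` sumset K0 (theta0 q) &
    K = K0 `|` translate (pt alpha v) (qinterior q (theta0 q))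
           `|` translate (pt u beta) (qinterior q (theta0 q))
           `|` vsegment c u t0 beta `|` hsegment d s0 v alpha] ->
  qcompact_convex_body q K.
Proof.
move=> [au bv s0a t0b] [cK0 cvxK0 triK0 K0hull] [K0K KK0 KE].
rewrite !translate_qinterior_theta0 in KE.
have {}triK0 : [set pt alpha v; pt alpha beta; pt u beta] `<=` K0.
  by move=> x xP; apply: triK0 => M [_]; exact.
have rectK0 x : K0 x -> [/\ alpha <= x.1, x.1 <= u, beta <= x.2 & x.2 <= v].
  move=> /K0hull/(_ [set x : plane R |
    [/\ alpha <= x.1, x.1 <= u, beta <= x.2 & x.2 <= v]]); apply.
  split; last by move=> y [[[]|]|] -> /=; split=> //; exact: ltW.
  by apply/convex_setP => y z t t_ge0 t_le1 [? ? ? ?] [? ? ? ?]; split=> /=; nra.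
split.
- have -> : K = [set x | [/\ x.1 <= u, x.2 <= v, x.1 = u -> edge t0 c beta x.2 &
                             x.2 = v -> edge s0 d alpha x.1]] `&`
    [set x | [/\ x.1 <= u, x.2 <= v & alpha <= x.1 -> beta <= x.2 -> K0 x]].
    rewrite KE; apply/seteqP; split=> x.
      have betaP := edge_up (c := c) t0b; have alphaP := edge_up (c := d) s0a.
      have eb : edge t0 c beta beta by apply: Or31.
      have ea : edge s0 d alpha alpha by apply: Or31.
      case=> [[[[K0x|[x1 x2]]|[x1 x2]]|/(vsegmentE _ _ _ t0b)[xu xb h]]|
              /hsegmentE/(vsegmentE _ _ _ s0a)/=[xv xa h]].
      + have [x1 x2 x3 x4] := rectK0 x K0x; split; split=> // _.
          exact: betaP eb.
        exact: alphaP ea.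
      + by split; split=> //; lra.
      + by split; split=> //; lra.
      + split; split=> //; try lra.
        (* On the right edge, beta <= x.2 leaves only the corner (u, beta). *)
        by move=> _ bx; rewrite [x]pt_eta xu (_ : x.2 = beta); [apply: triK0; right|lra].
      + split; split=> //; try lra.
        by move=> ax _; rewrite [x]pt_eta xv (_ : x.1 = alpha);
          [apply: triK0; left; left|lra].
    move=> [[x1 x2 xt xs] [_ _ xK0]].
    have [ax|xa] := leP alpha x.1; last first.
      move: x2; rewrite le_eqVlt => /predU1P[xv|xv]; last by do 3 left; right.
      right; apply/hsegmentE/vsegmentE => //; split=> //; first exact: ltW.
      exact: xs.
    have [bx|xb] := leP beta x.2; first by do 4 left; exact: xK0.
    move: x1; rewrite le_eqVlt => /predU1P[xu|xu]; last by left; left; right.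
    left; right; apply/vsegmentE => //; split=> //; first exact: ltW.
    exact: xt.
  have cE := @edges_convex R u v _ _ (edge_up (c := c) t0b) (edge_up (c := d) s0a).
  have cR := convex_rectangle_extension au bv cvxK0 rectK0 triK0.
  apply/convex_setP => x y t t_ge0 t_le1 [xE xR] [yE yR].
  by split; [exact: (convex_setP _).1 cE _ _ _ t_ge0 t_le1 xE yE|
             exact: (convex_setP _).1 cR _ _ _ t_ge0 t_le1 xR yR].
- apply: qcompact_dominated cK0 K0K _ => x /KK0[y K0y [z /theta0P[z1 z2] <-]].
  by exists y => //; split; rewrite /= gerDl.
- apply: (@qinterior_neq0 _ alpha v) => x x1 x2.
  by rewrite KE; do 3 left; right.
Qed.

End AsymmetricNorm.

Theorem theorem9 (R : realType) (q : plane R -> R) (K : set (plane R))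
    (hq : asym_lattice_norm q) :
  qcompact_convex_body q K <->
  (exists (u v : R) (t0 s0 : \bar R) (c d : bool),
     [/\ (t0 <= v%:E)%E, (s0 <= u%:E)%E &
       K = vsegment c u t0 v `|` hsegment d s0 v u
           `|` translate (pt u v) (qinterior q (theta0 q))])
  \/
  (exists (alpha u beta v : R) (s0 t0 : \bar R) (c d : bool)
     (K0 : set (plane R)),
     [/\ alpha < u, beta < v, (s0 <= alpha%:E)%E & (t0 <= beta%:E)%E] /\
     [/\ qcompact (sym_norm q) K0, convex_set K0,
         convex_hull [set pt alpha v; pt alpha beta; pt u beta] `<=` K0 &
         K0 `<=` convex_hull
                   [set pt alpha v; pt alpha beta; pt u beta; pt u v]] /\
     [/\ K0 `<=` K, K `<=` sumset K0 (theta0 q) &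
       K = K0 `|` translate (pt alpha v) (qinterior q (theta0 q))
              `|` translate (pt u beta) (qinterior q (theta0 q))
              `|` vsegment c u t0 beta `|` hsegment d s0 v alpha]).
Proof.
split=> [[cvxK cK intK]|[]].
- have [u [v [alpha [beta [Kub Kav Kle betaP alphaP]]]]] := body_corners hq cK intK.
  have [Kuv|nKuv] := pselect (K (pt u v)); [left|right].
    by exists u, v; exact: body_corner_form.
  by exists alpha, u, beta, v; exact: body_rectangle_form.
- by move=> [u [v [t0 [s0 [c [d [t0v s0u ->]]]]]]]; exact: corner_form_body.
- move=> [alpha [u [beta [v [s0 [t0 [c [d [K0 [bounds [K0P KP]]]]]]]]]]].
  exact: rectangle_form_body bounds K0P KP.
Qed.
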